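(* Let $\boldsymbol x_T=\sum_ts_t\boldsymbol1_{\mathcal C_t}$ be a finite convex combination of incidence vectors of bases $\mathcal C_t\in\mathcal B_B$, let $\mathcal C^0\in\mathcal B_B$ be obtained from $\boldsymbol x_T$ by deterministic pipage rounding, and let $\mathcal C_{\rm out}$ be the base returned by path-guided exchange (PGX) initialized at $\mathcal C^0$. Then $$F(\mathcal L(\mathcal C_{\rm out}))\le F(\mathcal L(\mathcal C^0)),\qquad v(\mathcal C_{\rm out})\ge v(\mathcal C^0)\ge\widetilde v(\boldsymbol x_T).$$
   Context: **Setting.** Let $R\ge1$. For $r=1,\dots,R$ let $\mathbf U_r\in\mathbb R^{N_r\times K_r}$ have full column rank, with $i$th row $(\boldsymbol u_i^{(r)})^\top$, $\mathcal N_r=\{1,\dots,N_r\}$, $N_\Sigma=\sum_rN_r$. For $\mathcal S\subseteq\mathcal N_r$ put $F_r(\mathcal S)=\sum_{i,j\in\mathcal S}((\boldsymbol u_i^{(r)})^\top\boldsymbol u_j^{(r)})^2$. For $\mathcal L=(\mathcal L_1,\dots,\mathcal L_R)$ with $\mathcal L_r\subseteq\mathcal N_r$ put $F(\mathcal L)=\prod_rF_r(\mathcal L_r)$, and $\mathcal N=(\mathcal N_1,\dots,\mathcal N_R)$. Ground set $\mathcal E=\bigcup_r(\{r\}\times\mathcal N_r)$; for $\mathcal C\subseteq\mathcal E$, $\mathcal C_r=\{i:(r,i)\in\mathcal C\}$, $\mathcal L(\mathcal C)=(\mathcal N_1\setminus\mathcal C_1,\dots,\mathcal N_R\setminus\mathcal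 C_R)$ and $v(\mathcal C)=1-F(\mathcal L(\mathcal C))/F(\mathcal N)$. Integers $\kappa_r$ with $K_r\le\kappa_r\le N_r$ and $L$ with $\sum_r\kappa_r\le L\le N_\Sigma$ are given; $B=N_\Sigma-L$ and $\mathcal B_B=\{\mathcal C\subseteq\mathcal E:|\mathcal C|=B,\ |\mathcal C_r|\le N_r-\kappa_r\ \forall r\}$. $\widetilde v$ is the multilinear extension of $v$: $\widetilde v(\boldsymbol x)=\sum_{\mathcal C\subseteq\mathcal E}v(\mathcal C)\prod_{e\in\mathcal C}x_e\prod_{e\notin\mathcal C}(1-x_e)$ on $[0,1]^{\mathcal E}$. $\phi_e$ denotes the Shapley value of $e\in\mathcal E$ in the cooperative game $(\mathcal E,v)$. **Deterministic pipage rounding.** Let $P$ be the convex hull of $\{\boldsymbol1_{\mathcal C}:\mathcal C\in\mathcal B_B\}$. Starting from $\boldsymbol x_T$, while the current point $\boldsymbol x\in P$ is not integral, choose distinct $i,j\in\mathcal E$ with fractional coordinates such that $\{\lambda:\boldsymbol x+\lambda(\boldsymbol e_i-\boldsymbol e_j)\in P\}=[\lambda_-,\lambda_+]$ with $\lambda_-<0<\lambda_+$, and move to the endpoint $\lambda\in\{\lambda_-,\lambda_+\}$ with the larger value of $\widetilde v(\boldsymbol x+\lambda(\boldsymbol e_i-\boldsymbol e_j))$. The final integral point is $\boldsymbol1_{\mathcal C^0}$. **PGX.** Start with $\mathcal C=\mathcal C^0$. Let $\mathcal P(\mathcal C)$ consist of the $\min(2L,|\mathcal C|)$ elements $e\in\mathcal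 C$ with lexicographically smallest $(x_{T,e},\phi_e)$ (any deterministic tie-breaking), and $\mathcal K(\mathcal C)=\mathcal E\setminus\mathcal C$. Among all $i\in\mathcal P(\mathcal C)$, $j\in\mathcal K(\mathcal C)$ with $\mathcal C-i+j:=(\mathcal C\setminus\{i\})\cup\{j\}\in\mathcal B_B$, find a pair minimizing $F(\mathcal L(\mathcal C-i+j))$. If this value is strictly smaller than $F(\mathcal L(\mathcal C))$, replace $\mathcal C$ by $\mathcal C-i+j$ and repeat (recomputing $\mathcal P,\mathcal K$); otherwise (or if no such pair exists) terminate and return $\mathcal C_{\rm out}=\mathcal C$. *)

(* Defs.v *)
From HB Require Import structures.
From mathcomp Require Import all_boot all_order all_algebra.
Set Implicit Arguments.
Unset Strict Implicit.
Unset Printing Implicit Defensive.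
Import Order.TTheory GRing.Theory Num.Theory.
Import Order.LexiSyntax.
Local Open Scope ring_scope.

(* [F : realFieldType] plays the role of the real numbers. *)

Section Games.
Variables (F : realFieldType) (E : finType).
Implicit Types (v : {set E} -> F) (C D : {set E}) (x y : {ffun E -> F}).

Definition indic C : {ffun E -> F} := [ffun e => (e \in C)%:R].

Definition shapley v (e : E) : F :=
  \sum_(C : {set E} | e \notin C)
     (#|C|`! * (#|E| - #|C| - 1)`!)%N%:R / (#|E|`!)%:R * (v (e |: C) - v C).

Definition multilin v x : F :=
  \sum_(C : {set E})
     v C * (\prod_(e in C) x e) * (\prod_(e | e \notin C) (1 - x e)).

Definition convex_weights (I : finType) (s : I -> F) : Prop :=
  (forall i, 0 <= s i) /\ \sum_i s i = 1.

Definition convex_comb (I : finType) (s : I -> F) (C : I -> {set E}) :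
    {ffun E -> F} :=
  [ffun e => \sum_i s i * indic (C i) e].

(* Convex hull of the incidence vectors of the members of [B]; since [B] is
   finite, it suffices to use one weight per set, vanishing outside [B]. *)
Definition in_hull (B : {set {set E}}) x : Prop :=
  exists w : {set E} -> F,
    [/\ convex_weights w, forall C, C \notin B -> w C = 0
      & x = convex_comb w id].

Definition integral x : Prop := forall e, x e = 0 \/ x e = 1.

Definition fractional x (e : E) : bool := 0 < x e < 1.

Definition shift x (i j : E) (t : F) : {ffun E -> F} :=
  [ffun e => x e + t * (indic [set i] e - indic [set j] e)].

(* [pipage B v x y]: some execution of the rounding procedure started at [x]
   halts at [y].  The pair [(i, j)] and, when both endpoints give the same
   value, the endpoint are left free, so every selection rule is covered. *)
Inductive pipage (B : {set {set E}}) v : {ffun E -> F} -> {ffun E -> F} -> Prop :=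
| pipage_stop x : in_hull B x -> integral x -> pipage B v x x
| pipage_move x y i j (lo hi t : F) :
    in_hull B x -> ~ integral x ->
    i != j -> fractional x i -> fractional x j ->
    (forall u, in_hull B (shift x i j u) <-> lo <= u <= hi) ->
    lo < 0 -> 0 < hi ->
    t = lo \/ t = hi ->
    multilin v (shift x i j lo) <= multilin v (shift x i j t) ->
    multilin v (shift x i j hi) <= multilin v (shift x i j t) ->
    pipage B v (shift x i j t) y ->
    pipage B v x y.

End Games.

Section Sampling.
Variables (F : realFieldType) (R : nat) (N K : 'I_R -> nat).
Variable U : forall r, 'M[F]_(N r, K r).

Definition pot1 (r : 'I_R) (S : {set 'I_(N r)}) : F :=
  \sum_(i in S) \sum_(j in S) ((row i (U r) *m (row j (U r))^T) 0 0) ^+ 2.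

Definition pot (S : forall r, {set 'I_(N r)}) : F := \prod_r pot1 (S r).

Definition ground : finType := {r : 'I_R & 'I_(N r)}.

Implicit Types C D : {set ground}.

Definition slice C (r : 'I_R) : {set 'I_(N r)} :=
  [set i | (Tagged (fun r => 'I_(N r)) i : ground) \in C].

Definition kept C : forall r, {set 'I_(N r)} := fun r => ~: slice C r.

Definition game C : F := 1 - pot (kept C) / pot (fun r => [set: 'I_(N r)]).

Variables (kappa : 'I_R -> nat) (L : nat).

Definition bases : {set {set ground}} :=
  [set C : {set ground} | (#|C| == (\sum_r N r - L)%N)
     && [forall r, (#|slice C r| <= N r - kappa r)%N]].

Definition lexkey (x : {ffun ground -> F}) (e : ground) : F *l F :=
  (x e, shapley game e).

(* [P] is an admissible pruned set at [C]: the admissible sets are exactly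
   those obtained by some way of breaking ties among equal keys. *)
Definition path_guided (x : {ffun ground -> F}) C (P : {set ground}) : Prop :=
  [/\ P \subset C, #|P| = minn (2 * L)%N #|C|
    & forall e f, e \in P -> f \in C :\: P ->
        (lexkey x e <= lexkey x f)%O].

Definition swap C (i j : ground) : {set ground} := j |: (C :\ i).

Definition candidate (P : {set ground}) C (i j : ground) : bool :=
  [&& i \in P, j \in ~: C & swap C i j \in bases].

Definition best_exchange (P : {set ground}) C (i j : ground) : Prop :=
  candidate P C i j /\
  forall i' j', candidate P C i' j' ->
    pot (kept (swap C i j)) <= pot (kept (swap C i' j')).

(* [pgx sel C D]: some execution of the exchange procedure started at [C],
   with pruning rule [sel], returns [D]; the minimizing pair is left free. *)
Inductive pgx (sel : {set ground} -> {set ground}) :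
    {set ground} -> {set ground} -> Prop :=
| pgx_none C : (forall i j, ~~ candidate (sel C) C i j) -> pgx sel C C
| pgx_stop C i j :
    best_exchange (sel C) C i j ->
    pot (kept C) <= pot (kept (swap C i j)) ->
    pgx sel C C
| pgx_move C D i j :
    best_exchange (sel C) C i j ->
    pot (kept (swap C i j)) < pot (kept C) ->
    pgx sel (swap C i j) D ->
    pgx sel C D.

End Sampling.

(* Main.v *)
(** Each [pot1] is a sum of nonnegative multiples of products of two indicators
    "[e] is kept", and each such indicator is nonnegative, antitone and modular
    in the removed set.  Nonnegative antitone supermodular set functions are
    stable under sums and products, so the potential is supermodular in the
    removed set and [game] is submodular.  Hence its multilinear extension is
    convex along every direction [e_i - e_j], a pipage step to the better
    endpoint cannot decrease it, and at an integral point it equals the game.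
    An exchange is only performed when it strictly decreases the potential. *)
Require Import Defs.
From HB Require Import structures.
From mathcomp Require Import all_boot all_order all_algebra.
From mathcomp Require Import ring lra.
Import Order.TTheory GRing.Theory Num.Theory.
Local Open Scope ring_scope.

Section SetFunctions.
Set Implicit Arguments.
Unset Strict Implicit.
Context {F : realFieldType} {E : finType}.
Implicit Types (f g v : {set E} -> F) (A B C : {set E}) (x : {ffun E -> F}).

(** * Calculus of nonnegative antitone supermodular set functions *)

Definition submodular v : Prop :=
  forall A B, v (A :|: B) + v (A :&: B) <= v A + v B.

Definition antitone_supermodular f : Prop :=
  [/\ forall A, 0 <= f A,
      forall A B, A \subset B -> f B <= f A
    & forall A B, f A + f B <= f (A :|: B) + f (A :&: B)].

Lemma antitone_supermodular_const (c : F) :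
  0 <= c -> antitone_supermodular (fun=> c).
Proof. by move=> c0; split=> // *; rewrite lexx. Qed.

(** Supermodularity alone is not stable under products. Here the signs and antitonicity allow the
    lower bounds on [f (A :&: B)] and [g (A :&: B)] to be multiplied. *)
Lemma antitone_supermodularM f g :
  antitone_supermodular f -> antitone_supermodular g ->
  antitone_supermodular (fun C => f C * g C).
Proof.
move=> [f0 fm fs] [g0 gm gs]; split=> [A|A B sAB|A B].
- by rewrite mulr_ge0.
- by rewrite ler_pM ?fm ?gm.
have fA : f (A :|: B) <= f A by rewrite fm ?subsetUl.
have fB : f (A :|: B) <= f B by rewrite fm ?subsetUr.
have gA : g (A :|: B) <= g A by rewrite gm ?subsetUl.
have gB : g (A :|: B) <= g B by rewrite gm ?subsetUr.
have fU := f0 (A :|: B); have gU := g0 (A :|: B).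
have le_fI : f A + f B - f (A :|: B) <= f (A :&: B) by have := fs A B; lra.
have le_gI : g A + g B - g (A :|: B) <= g (A :&: B) by have := gs A B; lra.
have := ler_pM _ _ le_fI le_gI.
have -> : 0 <= f A + f B - f (A :|: B) by lra.
have -> : 0 <= g A + g B - g (A :|: B) by lra.
move=> /(_ isT isT).
(* The product of the two lower bounds exceeds what is required by exactly this cross term plus the
   next one. *)
have : 0 <= (f A - f (A :|: B)) * (g B - g (A :|: B)) by rewrite mulr_ge0 ?subr_ge0.
have : 0 <= (f B - f (A :|: B)) * (g A - g (A :|: B)) by rewrite mulr_ge0 ?subr_ge0.
lra.
Qed.

Lemma antitone_supermodular_sum (I : finType) (f : I -> {set E} -> F) :
  (forall i, antitone_supermodular (f i)) ->
  antitone_supermodular (fun C => \sum_i f i C).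
Proof.
move=> fP; split=> [A|A B sAB|A B]; last rewrite -!big_split /=.
- by apply: sumr_ge0 => i _; case: (fP i).
- by apply: ler_sum => i _; case: (fP i) => _ fm _; apply: fm.
- by apply: ler_sum => i _; case: (fP i).
Qed.

Lemma eq_antitone_supermodular f g :
  f =1 g -> antitone_supermodular f -> antitone_supermodular g.
Proof.
move=> fg [f0 fm fs]; split=> [A|A B sAB|A B]; rewrite -!fg //; exact: fm.
Qed.

Lemma antitone_supermodular_prod (I : finType) (f : I -> {set E} -> F) :
  (forall i, antitone_supermodular (f i)) ->
  antitone_supermodular (fun C => \prod_i f i C).
Proof.
move=> fP; elim: (index_enum I) => [|i r IHr].
  apply: (@eq_antitone_supermodular (fun=> 1)) => [C|]; first by rewrite big_nil.
  exact/antitone_supermodular_const/ler01.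
apply: (@eq_antitone_supermodular (fun C => f i C * \prod_(j <- r) f j C)) => [C|].
  by rewrite big_cons.
exact: antitone_supermodularM.
Qed.

Lemma antitone_supermodular_notin (e : E) :
  antitone_supermodular (fun C => (e \notin C)%:R).
Proof.
split=> [A|A B /subsetP sAB|A B]; first exact: ler0n.
- by rewrite ler_nat; have := sAB e; case: (e \in A) => [->|_] //; case: (e \in B).
- by rewrite !inE -!natrD ler_nat; case: (e \in A); case: (e \in B).
Qed.

(** * The multilinear extension and its chords *)

Lemma multilinE v x :
  multilin v x = \sum_C v C * \prod_e (if e \in C then x e else 1 - x e).
Proof.
apply: eq_bigr => C _; rewrite -mulrA; congr (_ * _).
rewrite [RHS](bigID (mem C)) /=; congr (_ * _); apply: eq_bigr => e eC.
  by rewrite eC.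
by rewrite (negPf eC).
Qed.

Lemma multilin_indic v C : multilin v (indic F C) = v C.
Proof.
rewrite multilinE (bigD1 C) //= [X in _ + X]big1 ?addr0 => [|D neDC].
  rewrite big1 ?mulr1 // => e _; rewrite ffunE.
  by case: (e \in C); rewrite ?subr0.
(* An element separating [D] from [C] contributes a zero factor. *)
have [e De] : exists e, (e \in D) != (e \in C).
  apply/existsP; apply: contraR neDC; rewrite negb_exists => /forallP eDC.
  by apply/eqP/setP => e; apply/eqP; rewrite -[_ == _]negbK.
rewrite (bigD1 e) //= ffunE.
by move: De; case: (e \in D); case: (e \in C) => //= _;
  rewrite ?subrr mul0r mulr0.
Qed.

Lemma big_set_insert (P : pred {set E}) (i : E) (G : {set E} -> F) :
    (forall C, P (i |: C) = P C) ->
  \sum_(C | P C) G C = \sum_(C | P C && (i \notin C)) (G C + G (i |: C)).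
Proof.
move=> Pi; rewrite (bigID (fun C => i \notin C)) /= big_split /=; congr (_ + _).
rewrite (reindex_onto (fun C => i |: C) (fun C => C :\ i)) /=.
  apply: eq_bigl => C; rewrite Pi setU11 andbT; congr (_ && _).
  apply/eqP/idP => [<-|iC]; first by rewrite !inE eqxx.
  by rewrite setU1K.
by move=> C /andP[_]; rewrite negbK => iC; rewrite setD1K.
Qed.

(** Grouping subsets by their trace off [i] and [j] isolates a form bilinear in [x i] and [x j]; the
    remaining factor is constant along [shift x i j]. *)
Lemma multilin_pair v x (i j : E) : i != j ->
  multilin v x = \sum_(C : {set E} | (i \notin C) && (j \notin C))
    (\prod_(e | (e != i) && (e != j)) (if e \in C then x e else 1 - x e)) *
    ((1 - x i) * (1 - x j) * v C + x i * (1 - x j) * v (i |: C)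
     + (1 - x i) * x j * v (j |: C) + x i * x j * v (i |: (j |: C))).
Proof.
move=> neij; rewrite multilinE (@big_set_insert predT i) //=.
rewrite (@big_set_insert (fun C => i \notin C) j) /=; last first.
  by move=> C; rewrite !inE (negPf neij).
apply: eq_bigr => C /andP[iC jC].
have prodE D : (forall e, e != i -> e != j -> (e \in D) = (e \in C)) ->
    \prod_e (if e \in D then x e else 1 - x e) =
    (if i \in D then x i else 1 - x i) * (if j \in D then x j else 1 - x j) *
    \prod_(e | (e != i) && (e != j)) (if e \in C then x e else 1 - x e).
  move=> DC; rewrite (bigD1 i) //= (bigD1 j) 1?eq_sym //= mulrA; congr (_ * _).
  by apply: eq_bigr => e /andP[ei ej]; rewrite DC.
rewrite !prodE; try by move=> e /negPf ei /negPf ej; rewrite ?inE ?ei ?ej.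
rewrite !inE !eqxx [j == i]eq_sym !(negPf neij) (negPf iC) (negPf jC) /=.
ring.
Qed.

(** The chord inequality at step 0, cleared of the denominator [hi - lo]. Each group is quadratic in
    the step, with leading coefficient a nonnegative weight times the submodularity gap of [i |: C]
    and [j |: C]. *)
Lemma multilin_shift_convex v x (i j : E) (lo hi : F) :
    submodular v -> (forall e, 0 <= x e <= 1) -> i != j -> lo < 0 -> 0 < hi ->
  (hi - lo) * multilin v x <=
  hi * multilin v (shift x i j lo) - lo * multilin v (shift x i j hi).
Proof.
move=> vsub x01 neij lo0 hi0.
rewrite !(multilin_pair _ _ neij) !mulr_sumr -sumrB; apply: ler_sum => C /andP[iC jC].
have shiftE t : \prod_(e | (e != i) && (e != j))
      (if e \in C then shift x i j t e else 1 - shift x i j t e) =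
    \prod_(e | (e != i) && (e != j)) (if e \in C then x e else 1 - x e).
  apply: eq_bigr => e /andP[/negPf ei /negPf ej].
  by rewrite !ffunE !inE ei ej subrr mulr0 addr0.
rewrite !shiftE; set W := \prod_(e | _) _.
have W0 : 0 <= W.
  by apply: prodr_ge0 => e _; have /andP[? ?] := x01 e; case: ifP; rewrite ?subr_ge0.
rewrite !ffunE !inE !eqxx [j == i]eq_sym !(negPf neij).
have := vsub (i |: C) (j |: C).
have -> : (i |: C) :|: (j |: C) = i |: (j |: C).
  by apply/setP => e; rewrite !inE; case: (e == i); case: (e == j); case: (e \in C).
have -> : (i |: C) :&: (j |: C) = C.
  apply/setP => e; rewrite !inE.
  case: eqVneq => [->|_]; first by rewrite (negPf neij) (negPf iC).
  by case: (e == j) => //=; case: (e \in C).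
rewrite -subr_ge0 => d0.
rewrite -subr_ge0.
(* Only the quadratic term in the step length survives the chord difference. *)
have : 0 <= W * ((- lo * hi * (hi - lo)) *
    (v (i |: C) + v (j |: C) - (v (i |: (j |: C)) + v C))).
  by rewrite !mulr_ge0 // ?oppr_ge0; lra.
by congr (0 <= _); rewrite /=; ring.
Qed.

(** * Monotonicity of pipage rounding *)

Lemma in_hull_itv (B : {set {set E}}) x :
  in_hull B x -> forall e, 0 <= x e <= 1.
Proof.
move=> [w [[w0 w1] _ ->]] e; rewrite ffunE; apply/andP; split.
  by apply: sumr_ge0 => C _; rewrite ffunE mulr_ge0 ?ler0n.
rewrite -w1; apply: ler_sum => C _; rewrite ffunE ler_piMr //.
by case: (e \in _); rewrite ?ler01 ?lexx.
Qed.

Lemma pipage_multilin_le (B : {set {set E}}) v x y :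
  submodular v -> pipage B v x y -> multilin v x <= multilin v y.
Proof.
move=> vsub; elim=> {x y} // x y i j lo hi t /in_hull_itv x01 _ neij _ _ _
  lo0 hi0 _ le_lo le_hi _; apply: le_trans.
have hi_lo : 0 < hi - lo by lra.
rewrite -(ler_pM2l hi_lo).
apply: le_trans (multilin_shift_convex vsub x01 neij lo0 hi0) _.
(* The chosen endpoint dominates both ends, and the weights [hi] and [- lo] are positive with sum
   [hi - lo]. *)
by rewrite mulrBl -!mulNr; apply: lerD; apply: ler_wpM2l => //; lra.
Qed.

End SetFunctions.

Section Sampling.
Set Implicit Arguments.
Unset Strict Implicit.
Context {F : realFieldType} {R : nat} {N K : 'I_R -> nat}.
Variable U : forall r, 'M[F]_(N r, K r).

(** * The sampling potential, its game and the exchanges *)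

Lemma pot_ge0 (S : forall r, {set 'I_(N r)}) : 0 <= pot U S.
Proof.
apply: prodr_ge0 => r _; apply: sumr_ge0 => i _; apply: sumr_ge0 => j _.
exact: sqr_ge0.
Qed.

Lemma pot_kept_antitone_supermodular :
  antitone_supermodular (fun C : {set ground N} => pot U (kept C)).
Proof.
apply: antitone_supermodular_prod => r.
pose el i : ground N := Tagged (fun r => 'I_(N r)) (i : 'I_(N r)).
pose a i j := ((row i (U r) *m (row j (U r))^T) 0 0) ^+ 2.
(* Indicators replace the ranges depending on [C] by fixed ones, so that the closure lemmas
   apply. *)
apply: (@eq_antitone_supermodular _ _ (fun C => \sum_i \sum_j
    a i j * ((el i \notin C)%:R * (el j \notin C)%:R))) => [C|].
  rewrite /pot1 [RHS]big_mkcond; apply: eq_bigr => i _; rewrite !inE.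
  have [iC|iC] := boolP (el i \in C); rewrite /= ?iC.
    by rewrite big1 // => j _; rewrite mul0r mulr0.
  rewrite [RHS]big_mkcond; apply: eq_bigr => j _; rewrite !inE mul1r.
  by have [jC|jC] := boolP (el j \in C); rewrite /= ?mulr0 ?mulr1.
do 2!apply: antitone_supermodular_sum => ?.
apply: antitone_supermodularM; first exact/antitone_supermodular_const/sqr_ge0.
by apply: antitone_supermodularM; apply: antitone_supermodular_notin.
Qed.

Lemma game_submodular : submodular (game U).
Proof.
move=> A B; rewrite /game; have [_ _ /(_ A B)] := pot_kept_antitone_supermodular.
(* A weak sign suffices: the inverse of 0 is 0. *)
have : 0 <= (pot U (fun r => [set: 'I_(N r)]))^-1 by rewrite invr_ge0 pot_ge0.
move=> /ler_wpM2r h /h; rewrite !mulrDl; lra.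
Qed.

Lemma game_le (C D : {set ground N}) :
  pot U (kept D) <= pot U (kept C) -> game U C <= game U D.
Proof. by move=> le; rewrite lerB // ler_wpM2r // invr_ge0 pot_ge0. Qed.

Lemma pgx_pot_le (kappa : 'I_R -> nat) (L : nat)
    (sel : {set ground N} -> {set ground N}) (C D : {set ground N}) :
  pgx U kappa L sel C D -> pot U (kept D) <= pot U (kept C).
Proof. by elim=> {C D} // C D i j _ /ltW lt _ /le_trans; apply. Qed.

End Sampling.

Theorem lemma9 (F : realFieldType) (R : nat) (N K : 'I_R -> nat)
    (U : forall r, 'M[F]_(N r, K r)) (kappa : 'I_R -> nat) (L : nat)
    (hR : (1 <= R)%N)
    (hU : forall r, \rank (U r) = K r)
    (hkappa : forall r, (K r <= kappa r <= N r)%N)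
    (hL : (\sum_r kappa r <= L <= \sum_r N r)%N)
    (m : nat) (s : 'I_m -> F) (Ct : 'I_m -> {set ground N})
    (hs : convex_weights s)
    (hCt : forall t, Ct t \in bases N kappa L)
    (C0 : {set ground N})
    (hC0 : C0 \in bases N kappa L)
    (hpipage : pipage (bases N kappa L) (game U) (convex_comb s Ct) (indic F C0))
    (sel : {set ground N} -> {set ground N})
    (hsel : forall C, path_guided U L (convex_comb s Ct) C (sel C))
    (Cout : {set ground N})
    (hpgx : pgx U kappa L sel C0 Cout) :
  pot U (kept Cout) <= pot U (kept C0) /\
  multilin (game U) (convex_comb s Ct) <= game U C0 <= game U Cout.
Proof.
have le_pot := pgx_pot_le hpgx.
split=> //; rewrite (game_le le_pot) andbT -[leRHS]multilin_indic.
exact: pipage_multilin_le (game_submodular U) hpipage.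
Qed.
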